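(* For a positive integer $d$, let $\mathcal{T}_d$ be the class of trees all of whose non-leaf vertices have degree at least $d$. Then every tree in $\mathcal{T}_d$ is well-burnable when $d\ge4$, and every tree in $\mathcal{T}_3$ on at least $81$ vertices is well-burnable.
   Context: Burning process on a graph $G$: in round 1 one vertex is chosen and set on fire; in each subsequent round, first every burning vertex sets all its neighbours on fire, then one new vertex is chosen and set on fire; the process ends when all vertices are on fire. The burning number $b(G)$ is the minimum number of rounds needed. A graph on $n$ vertices is well-burnable if $b(G)\le\lceil\sqrt n\,\rceil$. *)

(* Defs.v *)
From HB Require Import structures.
From mathcomp Require Import all_boot all_order all_algebra all_field.

Set Implicit Arguments.
Unset Strict Implicit.
Unset Printing Implicit Defensive.

Import Num.Theory.

Definition simple_graph (T : finType) (e : rel T) : Prop :=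
  symmetric e /\ irreflexive e.

Definition degree (T : finType) (e : rel T) (x : T) : nat := #|[set y | e x y]|.

Definition leaf (T : finType) (e : rel T) (x : T) : bool := degree e x == 1.

Definition connected_graph (T : finType) (e : rel T) : Prop :=
  0 < #|T| /\ forall x y : T, connect e x y.

(* [ucycle e c] accepts [[:: x; y]] for any edge, so that graph cycles are the
   [ucycle]s with at least three vertices. *)
Definition acyclic_graph (T : finType) (e : rel T) : Prop :=
  forall c : seq T, ucycle e c -> ~ (3 <= size c).

Definition tree (T : finType) (e : rel T) : Prop :=
  [/\ simple_graph e, connected_graph e & acyclic_graph e].

Definition tree_class (d : nat) (T : finType) (e : rel T) : Prop :=
  tree e /\ forall x : T, ~~ leaf e x -> d <= degree e x.

Definition spread (T : finType) (e : rel T) (B : {set T}) : {set T} :=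
  B :|: [set y | [exists x in B, e x y]].

(* [burning_process e B s]: from the set [B] of burning vertices, the process
   runs for exactly [size s] further rounds, [s] listing the chosen vertices in
   order, and then ends. The chosen vertex must be unburned after the fire has
   spread, unless no unburned vertex is left, when the choice has no effect.
   Since [spread e set0 = set0], starting from [set0] the first round only sets
   the first chosen vertex on fire. *)
Fixpoint burning_process (T : finType) (e : rel T) (B : {set T}) (s : seq T)
    : bool :=
  if s is x :: s' then
    [&& B != [set: T],
        (x \notin spread e B) || (spread e B == [set: T])
      & burning_process e (x |: spread e B) s']
  else B == [set: T].

Definition burns_in (T : finType) (e : rel T) (k : nat) : bool :=
  [exists s : k.-tuple T, burning_process e set0 s].

Lemma burning_process_ends (T : finType) (e : rel T) (B : {set T}) :
  exists s : seq T, burning_process e B s.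
Proof.
have [n] := ubnP #|~: B|; elim: n B => // n IHn B ltBn.
have [->|nB] := eqVneq B [set: T]; first by exists [::] => /=.
have [x chx nBx] : exists2 x,
    (x \notin spread e B) || (spread e B == [set: T]) & x \notin B.
  have [eST|nS] := eqVneq (spread e B) [set: T].
    have /subsetPn[x _ nBx] : ~~ ([set: T] \subset B) by rewrite subTset.
    by exists x; rewrite // orbT.
  have /subsetPn[x _ nSx] : ~~ ([set: T] \subset spread e B) by rewrite subTset.
  by exists x; rewrite ?nSx //; apply: contra nSx; rewrite inE => ->.
have [|s burn_s] := IHn (x |: spread e B).
  rewrite -ltnS (leq_trans _ ltBn) // ltnS proper_card // properE; apply/andP.
  split; first by rewrite setCS; apply/subsetP=> y yB; rewrite !inE yB orbT.
  by apply/subsetPn; exists x; rewrite !inE ?eqxx.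
by exists (x :: s); rewrite /= nB chx.
Qed.

Lemma burns_in_exists (T : finType) (e : rel T) : exists k, burns_in e k.
Proof.
have [s burn_s] := burning_process_ends e set0.
by exists (size s); apply/existsP; exists (in_tuple s).
Qed.

Definition burning_number (T : finType) (e : rel T) : nat :=
  ex_minn (burns_in_exists e).

(* The square root is taken in the field of algebraic numbers. *)
Definition ceil_sqrt (n : nat) : int := Num.ceil (sqrtC (n%:R : algC))%R.

Definition well_burnable (T : finType) (e : rel T) : Prop :=
  ((burning_number e)%:Z <= ceil_sqrt #|T|)%R.

(* Main.v *)
(** Root the tree at an internal vertex, if there is one. The set [S] of parents
    then consists of internal vertices, and it is enough to cover [S] by balls
    of radii [0, ..., s - 1] where [s + 1 = k >= sqrt n], since one more round
    burns all the leaves. By the handshake lemma, [2 * #|S| + 2 <= n] unless the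
    tree is an edge, so that [#|S| <= (s ^ 2 + 2 s - 1) / 2].

    Pruning the branch at distance [r] above a deepest vertex uses a ball of
    radius [r] and removes at least [r + 1] vertices, which covers sets of size
    [s (s + 1) / 2]. The missing [(s - 1) / 2] vertices are gained as follows:
    with the largest radius [r], either the branch has at least [r + 2]
    vertices, a gain of one, or it is a path on [r + 1] vertices, for which the
    radius [ceil (r / 2)] is enough, a gain of [floor (r / 2)] at once. *)

Require Import Defs.
From mathcomp Require Import all_boot all_order all_algebra all_field.
From mathcomp Require Import zify.

Set Implicit Arguments.
Unset Strict Implicit.
Unset Printing Implicit Defensive.

Import Order.TTheory GRing.Theory Num.Theory.

Section Balls.

Variables (T : finType) (e : rel T).

Lemma sub_spread (B : {set T}) : B \subset spread e B.
Proof. exact: subsetUl. Qed.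

Lemma spreadP (B : {set T}) (y : T) :
  reflect (y \in B \/ exists2 x, x \in B & e x y) (y \in spread e B).
Proof.
apply: (iffP setUP) => -[yB|]; [by left| |by left|].
  by rewrite inE => /exists_inP; right.
by right; rewrite inE; apply/exists_inP.
Qed.

Lemma mem_spread (B : {set T}) (x y : T) :
  x \in B -> e x y -> y \in spread e B.
Proof. by move=> xB exy; apply/spreadP; right; exists x. Qed.

Lemma spreadS (A B : {set T}) : A \subset B -> spread e A \subset spread e B.
Proof.
move=> /subsetP sAB; apply/subsetP=> y /spreadP[/sAB|[x /sAB xB exy]].
  exact/subsetP/sub_spread.
exact: mem_spread exy.
Qed.

Definition ball (r : nat) (c : T) : {set T} := iter r (spread e) [set c].

Lemma mem_ball_center (r : nat) (c : T) : c \in ball r c.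
Proof.
by elim: r => [|r IHr]; [rewrite inE | apply/subsetP/IHr/sub_spread].
Qed.

Lemma mem_ball1 (x y : T) : (y \in ball 1 x) = (y == x) || e x y.
Proof.
apply/spreadP/predU1P; rewrite inE => -[/eqP|]; [by left| |by left|right].
  by case=> z /set1P->; right.
by exists x; rewrite ?set11.
Qed.

Lemma ball_trans (r s : nat) (x y z : T) :
  x \in ball r y -> y \in ball s z -> x \in ball (r + s) z.
Proof.
rewrite /ball iterD => xy yz; apply: subsetP xy.
by elim: r => [|r IHr]; rewrite ?sub1set //=; apply: spreadS.
Qed.

Lemma ball_leq (r s : nat) (c : T) : r <= s -> ball r c \subset ball s c.
Proof.
move=> /subnKC <-; apply/subsetP=> x xr.
exact: ball_trans xr (mem_ball_center _ _).
Qed.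

Lemma mem_ball_sym (r : nat) (x y : T) :
  symmetric e -> x \in ball r y -> y \in ball r x.
Proof.
move=> syme; elim: r x => [|r IHr] x; first by rewrite !inE eq_sym.
case/spreadP=> [/IHr|[z /IHr yz ezx]].
  exact/subsetP/ball_leq.
by rewrite -addn1; apply: ball_trans yz _; rewrite mem_ball1 syme ezx orbT.
Qed.

Lemma connect_ball (x y : T) : connect e x y -> exists r, y \in ball r x.
Proof.
case/connectP=> q + ->; elim: q x => [|z q IHq] x /=.
  by exists 0; rewrite inE.
case/andP=> exz /IHq[r zr]; exists (r + 1).
by apply: ball_trans zr _; rewrite mem_ball1 exz orbT.
Qed.

(* [L] is used as a set of radii: each of them serves for one ball only. *)
Definition ball_coverable (L : seq nat) (S : {set T}) : Prop :=
  exists f : nat -> T,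
    forall x, x \in S -> exists2 r, r \in L & x \in ball r (f r).

Lemma ball_coverable0 (c : T) (L : seq nat) : ball_coverable L set0.
Proof. by exists (fun=> c) => x; rewrite inE. Qed.

Lemma ball_coverable_sub (L L' : seq nat) (S : {set T}) :
  {subset L <= L'} -> ball_coverable L S -> ball_coverable L' S.
Proof. by move=> sL [f cov]; exists f => x /cov[r /sL rL xr]; exists r. Qed.

Lemma ball_coverable_cons (r : nat) (L : seq nat) (c : T) (S D : {set T}) :
  S :&: D \subset ball r c -> r \notin L -> ball_coverable L (S :\: D) ->
  ball_coverable (r :: L) S.
Proof.
move=> /subsetP sD rL [f cov].
exists (fun i => if i == r then c else f i) => x xS.
have [xD|nxD] := boolP (x \in D).
  by exists r; rewrite ?mem_head // eqxx; apply: sD; rewrite inE xS.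
have [|i iL xi] := cov x; first by rewrite inE nxD.
exists i; rewrite ?inE ?iL ?orbT //.
by case: eqP => // eir; rewrite -eir iL in rL.
Qed.

Lemma ball_coverable_spread (L : seq nat) (S : {set T}) :
  ball_coverable L S -> ball_coverable (map succn L) (spread e S).
Proof.
case=> f cov; exists (f \o predn) => x.
case/spreadP=> [/cov[r rL xr]|[y /cov[r rL yr] eyx]];
  exists r.+1; rewrite ?map_f //=; last exact: mem_spread eyx.
by apply: subsetP xr; apply: sub_spread.
Qed.

End Balls.

Section Fire.

Variables (T : finType) (e : rel T).

Definition fire (B : {set T}) (cs : seq T) : {set T} :=
  foldl (fun A c => c |: spread e A) B cs.

Lemma fireS (cs : seq T) (A B : {set T}) :
  A \subset B -> fire A cs \subset fire B cs.
Proof. by elim: cs A B => //= c cs IHcs A B sAB; apply/IHcs/setUS/spreadS. Qed.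

Lemma ball_sub_fire_rev (c0 : T) (cs : seq T) (r : nat) (B : {set T}) :
  r < size cs -> ball e r (nth c0 cs r) \subset fire B (rev cs).
Proof.
rewrite /fire foldl_rev; elim: cs r => //= c cs IHcs [_|r /IHcs sr].
  exact: subsetUl.
exact: subset_trans (spreadS e sr) (subsetUr _ _).
Qed.

(* A chosen vertex that already burns is traded for an unburned one, which can
   only enlarge the fire. *)
Lemma fire_burning_process (cs : seq T) (B : {set T}) :
  fire B cs = [set: T] ->
  exists2 s : seq T, size s <= size cs & burning_process e B s.
Proof.
elim: cs B => [|c cs IHcs] B /=; first by move=> ->; exists [::] => /=.
have [-> _|nB burn] := eqVneq B [set: T]; first by exists [::] => /=.
have [c' choosable sub] :
    exists2 c', (c' \notin spread e B) || (spread e B == [set: T])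
    & c |: spread e B \subset c' |: spread e B.
  have [|] := boolP ((c \notin spread e B) || (spread e B == [set: T])).
    by exists c.
  rewrite negb_or negbK => /andP[cB nS].
  have /subsetPn[y _ ynS] : ~~ ([set: T] \subset spread e B) by rewrite subTset.
  exists y; rewrite ?ynS //; apply/subsetP=> z; rewrite in_setU1.
  by case/predU1P=> [->|zB]; rewrite in_setU1 ?cB ?zB orbT.
have [|s le_s burn_s] := IHcs (c' |: spread e B).
  by apply/eqP; rewrite -subTset -burn; apply: fireS.
by exists (c' :: s); rewrite //= nB choosable.
Qed.

Lemma ball_coverable_burning_number (k : nat) :
  ball_coverable e (iota 0 k) [set: T] -> burning_number e <= k.
Proof.
case=> f cov; have [|s] := @fire_burning_process (rev (mkseq f k)) set0.
  apply/setP=> x; have [r] := cov x (in_setT x).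
  rewrite mem_iota inE /= => lt_rk xr.
  have := @ball_sub_fire_rev x (mkseq f k) r set0.
  by rewrite size_mkseq nth_mkseq // => /(_ lt_rk)/subsetP; apply.
rewrite size_rev size_mkseq => le_s burn_s.
rewrite /burning_number; case: ex_minnP => m _ min_m.
by apply: leq_trans le_s; apply/min_m/existsP; exists (in_tuple s).
Qed.

End Fire.

Definition parent_map (T : finType) (e : rel T) (rho : T) (p : T -> T) : Prop :=
  [/\ p rho = rho, forall x, x != rho -> e x (p x)
    & forall x, fconnect p x rho].

Lemma connected_parent_map (T : finType) (e : rel T) (rho : T) :
  symmetric e -> (forall x, connect e rho x) -> exists p, parent_map e rho p.
Proof.
move=> syme conn.
pose dist x := ex_minn (connect_ball (conn x)).
have dist_leq x n : x \in ball e n rho -> dist x <= n.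
  by rewrite /dist; case: ex_minnP => m _; apply.
have nearer x : x != rho -> exists y, e x y && (dist y < dist x).
  rewrite {2}/dist; case: ex_minnP => -[|n].
    by rewrite inE => /eqP->; rewrite eqxx.
  case/spreadP=> [xn /(_ n xn)|[y yn eyx] _ _]; first by rewrite ltnn.
  by exists y; rewrite syme eyx ltnS dist_leq.
pose p x := odflt x [pick y | e x y && (dist y < dist x)].
have parent_nearer x : x != rho -> e x (p x) /\ dist (p x) < dist x.
  rewrite /p; case: pickP => [y /andP[] //|none /nearer[y]].
  by rewrite none.
exists p; split=> [|x /parent_nearer[] //|x].
  rewrite /p; case: pickP => //= y /andP[_].
  by rewrite ltnNge (leq_trans (dist_leq rho 0 _)) ?mem_ball_center.
have [n] := ubnP (dist x); elim: n x => // n IHn x lt_n.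
have [->|/parent_nearer[_ lt_p]] := eqVneq x rho; first exact: connect0.
by apply: connect_trans (fconnect1 p x) (IHn _ _); lia.
Qed.

Section ParentMap.

Variables (T : finType) (e : rel T) (rho : T) (p : T -> T).
Hypotheses (syme : symmetric e) (rooted : parent_map e rho p).

Definition depth (x : T) : nat := findex p x rho.

Lemma depth_root : depth rho = 0.
Proof. exact: findex0. Qed.

Lemma iter_depth (x : T) : iter (depth x) p x = rho.
Proof. by have [_ _ conn] := rooted; apply: iter_findex. Qed.

Lemma depth_parent (x : T) : depth (p x) = (depth x).-1.
Proof.
have [prho _ conn] := rooted; have [->|nx] := eqVneq x rho.
  by rewrite prho depth_root.
by rewrite /depth (fconnect_findex (conn x)) // eq_sym.
Qed.

Lemma depth_eq0 (x : T) : (depth x == 0) = (x == rho).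
Proof.
apply/eqP/eqP=> [d0|->]; last exact: depth_root.
by have := iter_depth x; rewrite d0.
Qed.

Lemma depth_iter (i : nat) (x : T) : depth (iter i p x) = depth x - i.
Proof. by elim: i => [|i IHi]; rewrite ?subn0 //= depth_parent IHi subnS. Qed.

Lemma iter_root (i : nat) (x : T) : depth x <= i -> iter i p x = rho.
Proof. by move=> le_i; apply/eqP; rewrite -depth_eq0 depth_iter subn_eq0. Qed.

Lemma grandparent_neq (x : T) : x != rho -> p (p x) != x.
Proof.
rewrite -depth_eq0; apply: contraNneq => eq_x.
by have := depth_iter 2 x; rewrite /= eq_x; lia.
Qed.

Lemma findex_depth (x y : T) :
  fconnect p x y -> findex p x y = depth x - depth y.
Proof.
move=> pxy; have [->|] := eqVneq y rho; first by rewrite depth_root subn0.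
by rewrite -depth_eq0 -{1 3}(iter_findex pxy) depth_iter; lia.
Qed.

Lemma uniq_traject_depth (r : nat) (x : T) :
  r <= depth x -> uniq (traject p x r.+1).
Proof.
move=> le_r; have [_ _ conn] := rooted.
rewrite -(@take_traject _ p (order p x)) ?take_uniq ?orbit_uniq //.
exact: leq_ltn_trans le_r (findex_max (conn x)).
Qed.

Lemma iter_mem_ball (i : nat) (x : T) : iter i p x \in ball e i x.
Proof.
have [prho par _] := rooted; elim: i => [|i IHi]; first by rewrite inE.
rewrite -add1n; apply: ball_trans IHi; rewrite /= mem_ball1.
case: eqVneq => //= npx; apply: par.
by apply: contraNneq npx => ->; rewrite prho.
Qed.

Lemma mem_ball_iter (i : nat) (x : T) : x \in ball e i (iter i p x).
Proof. exact/mem_ball_sym/iter_mem_ball. Qed.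

Lemma traject_sub_ball (h r : nat) (x y : T) :
  r <= h.*2 -> y \in traject p x r.+1 -> y \in ball e h (iter h p x).
Proof.
move=> le_r /trajectP[i lt_i ->]; have [le_hi|/ltnW le_ih] := leqP h i.
- have -> : iter i p x = iter (i - h) p (iter h p x) by rewrite -iterD subnK.
  by apply: subsetP (iter_mem_ball _ _); apply: ball_leq; lia.
- have -> : iter h p x = iter (h - i) p (iter i p x) by rewrite -iterD subnK.
  by apply: subsetP (mem_ball_iter _ _); apply: ball_leq; lia.
Qed.

Lemma spread_parents : spread e (p @: [set: T]) = [set: T].
Proof.
have [prho par _] := rooted; apply/setP=> x; rewrite [RHS]inE; apply/spreadP.
have [->|/par exp] := eqVneq x rho; first by left; rewrite -prho imset_f.
by right; exists (p x); rewrite ?imset_f // syme.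
Qed.

Definition descendants (v : T) : {set T} := [set x | fconnect p x v].

Lemma parent_closedD (S : {set T}) (v : T) :
  {homo p : x / x \in S} -> {homo p : x / x \in S :\: descendants v}.
Proof.
move=> clS x /setDP[xS nx]; rewrite !inE clS // andbT; apply: contra nx.
by rewrite inE; apply: connect_trans (fconnect1 p x).
Qed.

Section Branch.

Variables (S : {set T}) (x : T) (r : nat).
Hypotheses (clS : {homo p : y / y \in S}) (xS : x \in S).

Local Notation D := (descendants (iter r p x)).

Lemma branch_sub_ball :
  (forall y, y \in S -> depth y <= depth x) ->
  S :&: D \subset ball e r (iter r p x).
Proof.
move=> deepest; apply/subsetP=> y; rewrite !inE => /andP[/deepest le_y yD].
have := mem_ball_iter (findex p y (iter r p x)) y; rewrite iter_findex //.
apply/subsetP/ball_leq; rewrite findex_depth // depth_iter leq_subLR.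
by rewrite addnC -maxnE (leq_trans le_y) ?leq_maxr.
Qed.

Lemma traject_sub_branch : {subset traject p x r.+1 <= S :&: D}.
Proof.
move=> y /trajectP[i lt_i ->]; rewrite !inE; apply/andP; split.
  by elim: i {lt_i} => //= i; apply: clS.
by rewrite -(@subnK i r) // iterD fconnect_iter.
Qed.

Lemma prune_eq0_or_uniq_traject : S :\: D = set0 \/ uniq (traject p x r.+1).
Proof.
have [_ _ conn] := rooted.
have [le_r|/ltnW le_r] := leqP (depth x) r; [left|right].
  apply/eqP; rewrite setD_eq0; apply/subsetP=> y _.
  by rewrite inE iter_root.
exact: uniq_traject_depth.
Qed.

Lemma card_prune : #|S :\: D| <= #|S| - r.+1.
Proof.
case: prune_eq0_or_uniq_traject => [->|uniq_path]; first by rewrite cards0.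
rewrite cardsD leq_sub2l //; apply/card_geqP; exists (traject p x r.+1).
by split; [exact: uniq_path | exact: size_traject | exact: traject_sub_branch].
Qed.

Lemma card_prune_or_path :
  #|S :\: D| <= #|S| - r.+2 \/
  S :&: D \subset ball e (uphalf r) (iter (uphalf r) p x).
Proof.
case: prune_eq0_or_uniq_traject => [->|uniq_path].
  by left; rewrite cards0.
have [gt_D|le_D] := ltnP r.+1 #|S :&: D|.
  by left; rewrite cardsD leq_sub2l.
right; have /subsetP sub_branch := traject_sub_branch.
have branchE : traject p x r.+1 =i S :&: D.
  apply/subset_cardP=> //; apply/eqP; rewrite eqn_leq subset_leq_card //.
  by rewrite (card_uniqP uniq_path) size_traject.
by apply/subsetP=> y; rewrite -branchE; apply: traject_sub_ball; lia.
Qed.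

End Branch.

Lemma ex_deepest (S : {set T}) :
  S != set0 -> exists2 x, x \in S & forall y, y \in S -> depth y <= depth x.
Proof. by case/set0Pn=> x0 /(arg_maxnP depth)[x]; exists x. Qed.

Lemma ball_coverable_greedy (L : seq nat) (S : {set T}) :
  {homo p : x / x \in S} -> uniq L -> #|S| <= \sum_(r <- L) r.+1 ->
  ball_coverable e L S.
Proof.
elim: L S => [|r L IHL] S clS.
  by rewrite big_nil leqn0 cards_eq0 => _ /eqP->; apply: ball_coverable0 rho _.
rewrite big_cons => /andP[rL uL] le_S.
have [->|/ex_deepest[x xS deepest]] := eqVneq S set0.
  exact: ball_coverable0 rho _.
apply: ball_coverable_cons (branch_sub_ball r deepest) rL _.
apply: IHL => //; first exact: parent_closedD.
by have := card_prune r clS xS; lia.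
Qed.

Lemma sum_iota_succ (s : nat) : \sum_(r <- iota 0 s) r.+1 = 'C(s.+1, 2).
Proof. by rewrite -bin2_sum big_nat_recl // /index_iota subn0. Qed.

Lemma ball_coverable_iota (s : nat) (S : {set T}) :
  {homo p : x / x \in S} -> #|S| <= 'C(s.+1, 2) + s.-1./2 ->
  ball_coverable e (iota 0 s) S.
Proof.
elim: s S => [|r IHr] S clS le_S.
  by apply: ball_coverable_greedy; rewrite ?big_nil.
have [->|/ex_deepest[x xS deepest]] := eqVneq S set0.
  exact: ball_coverable0 rho _.
have clD := parent_closedD (v := iter r p x) clS.
rewrite binS bin1 /= in le_S.
have [le_prune|path_ball] := card_prune_or_path r clS xS.
  apply: (@ball_coverable_sub _ _ (r :: iota 0 r)) => [i|].
    by rewrite inE !mem_iota; lia.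
  apply: ball_coverable_cons (branch_sub_ball r deepest) _ _.
    by rewrite mem_iota; lia.
  by apply: IHr => //; lia.
set h := uphalf r in path_ball.
have h_in : h \in iota 0 r.+1 by rewrite mem_iota /h; lia.
apply: (@ball_coverable_sub _ _ (h :: rem h (iota 0 r.+1))) => [i|].
  by rewrite -(perm_mem (perm_to_rem h_in)).
apply: ball_coverable_cons path_ball _ _.
  by rewrite mem_rem_uniqF ?iota_uniq.
apply: ball_coverable_greedy => //; first exact/rem_uniq/iota_uniq.
have := sum_iota_succ r.+1; rewrite (big_rem h) //= binS bin1.
by have := card_prune r clS xS; rewrite /h; lia.
Qed.

End ParentMap.

Definition del_edge (T : finType) (e : rel T) (x y : T) : rel T :=
  [rel a b | e a b && ((a, b) \notin [:: (x, y); (y, x)])].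

Lemma acyclic_bridge (T : finType) (e : rel T) (x y : T) :
  simple_graph e -> acyclic_graph e -> e x y -> ~~ connect (del_edge e x y) x y.
Proof.
move=> [syme irre] acyc exy.
apply/negP=> /connectP[_ /shortenP[q path_q uniq_q _] last_q].
apply: (acyc (x :: q)).
  rewrite /ucycle uniq_q andbT /= rcons_path -last_q syme exy andbT.
  by apply: sub_path path_q => a b /andP[].
case: q path_q last_q {uniq_q} => [|a [|b q]] //= => [_ eyx|].
  by rewrite eyx irre in exy.
by move=> /andP[/andP[_ +] _] eya; rewrite eya inE eqxx.
Qed.

Section TreeEdges.

Variables (T : finType) (e : rel T) (rho : T) (p : T -> T).
Hypotheses (tree_e : tree e) (rooted : parent_map e rho p).

Lemma tree_edgeE (x y : T) :
  e x y = (x != rho) && (y == p x) || (y != rho) && (x == p y).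
Proof.
have [[syme irre] _ acyc] := tree_e; have [prho par conn] := rooted.
apply/idP/orP=> [exy|[]/andP[/par + /eqP->] //]; last by rewrite syme.
apply/orP; apply: contraLR (acyclic_bridge (conj syme irre) acyc exy).
rewrite negb_or !negb_and !negbK => /andP[nyx nxy].
(* If neither end is the parent of the other, then both remain connected to the
   root without the edge between them. *)
have sym_del : symmetric (del_edge e x y).
  move=> a b; rewrite /del_edge /= syme !inE !xpair_eqE orbC.
  by rewrite ![(b == _) && _]andbC.
have to_root z : connect (del_edge e x y) z rho.
  apply: connect_sub (conn z) => {}z _ /eqP<-.
  have [->|nz] := eqVneq z rho; first by rewrite prho.
  apply: connect1; rewrite /del_edge /= par //= !inE !xpair_eqE; apply/norP.
  by split; apply/andP=> -[/eqP ez /eqP ep]; move: nyx nxy;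
    rewrite -ez -ep eqxx (negbTE nz) ?orbF.
by apply: connect_trans (to_root x) _; rewrite (sym_connect_sym sym_del).
Qed.

Lemma tree_sum_degree : \sum_x degree e x = (#|T|.-1).*2.
Proof.
have [[syme _] _ _] := tree_e.
pose up x y : nat := (x != rho) && (y == p x).
have degreeE x : degree e x = \sum_y (up x y + up y x).
  rewrite /degree -sum1_card big_mkcond /=; apply: eq_bigr => y _.
  rewrite inE tree_edgeE /up.
  have [/andP[nx /eqP->]|_] := boolP ((x != rho) && _); last by case: (_ && _).
  by rewrite [x == _]eq_sym (negbTE (grandparent_neq rooted nx)) andbF.
have sum_up : \sum_x \sum_y up x y = #|T|.-1.
  rewrite -(cardsC1 rho) -sum1_card [RHS]big_mkcond /=; apply: eq_bigr => x _.
  rewrite !inE /up; case: (x != rho) => /=; last by rewrite big1.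
  by rewrite (bigD1 (p x)) //= eqxx big1 // => y /negbTE->.
rewrite (eq_bigr _ (fun x _ => degreeE x)).
under eq_bigr do rewrite big_split /=.
by rewrite big_split /= [X in _ + X]exchange_big /= !sum_up addnn.
Qed.

End TreeEdges.

Definition internal (T : finType) (e : rel T) : {set T} :=
  [set x | ~~ leaf e x].

Lemma card_internal_leq (d : nat) (T : finType) (e : rel T) :
  0 < d -> tree_class d e -> d.-1 * #|internal e| + 2 <= #|T|.
Proof.
move=> d_gt0 [tree_e deg]; have [[syme _] [T_gt0 conn] _] := tree_e.
have [rho _] := card_gt0P T_gt0.
have [p rooted] := connected_parent_map syme (conn rho).
have : \sum_x ((if x \in internal e then d.-1 else 0) + 1) <= \sum_x degree e x.
  apply: leq_sum => x _; rewrite inE.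
  by case: (boolP (leaf e x)) => [/eqP->|/deg] /=; lia.
rewrite (tree_sum_degree tree_e rooted) big_split -big_mkcond /= sum_nat_const.
by rewrite (sum1_card {: T}) mulnC; move: T_gt0; rewrite -!cardsT; lia.
Qed.

Lemma parents_sub_internal (T : finType) (e : rel T) (rho : T) (p : T -> T) :
  tree e -> parent_map e rho p -> p @: [set: T] \subset rho |: internal e.
Proof.
move=> [[syme _] _ _] rooted; have [prho par _] := rooted.
apply/subsetP=> _ /imsetP[x _ ->]; rewrite !inE.
have [->|nx] := eqVneq x rho; first by rewrite prho eqxx.
have [//|npx /=] := eqVneq (p x) rho.
have : #|[set x; p (p x)]| <= degree e (p x).
  apply/subset_leq_card/subsetP=> y; rewrite !inE.
  by case/pred2P=> ->; rewrite ?par // syme par.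
by rewrite cards2 eq_sym (grandparent_neq rooted nx) /leaf; lia.
Qed.

Lemma ex_root_internal (T : finType) (e : rel T) :
  tree e -> exists rho, #|rho |: internal e| <= maxn 1 #|internal e|.
Proof.
move=> [_ [T_gt0 _] _]; have [eq0|[rho rho_in]] := set_0Vmem (internal e).
  have [rho _] := card_gt0P T_gt0; exists rho.
  by rewrite eq0 setU0 cards1 leq_maxl.
by exists rho; rewrite (setUidPr _) ?leq_maxr // sub1set.
Qed.

Lemma tree_burning_number (T : finType) (e : rel T) (s : nat) :
  tree e -> maxn 1 #|internal e| <= 'C(s.+1, 2) + s.-1./2 ->
  burning_number e <= s.+1.
Proof.
move=> tree_e le_int; have [[syme _] [_ conn] _] := tree_e.
have [rho le_rho] := ex_root_internal tree_e.
have [p rooted] := connected_parent_map syme (conn rho).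
have cov : ball_coverable e (iota 0 s) (p @: [set: T]).
  apply: (ball_coverable_iota syme rooted); first by move=> x _; apply: imset_f.
  apply: leq_trans (leq_trans le_rho le_int).
  exact/subset_leq_card/parents_sub_internal.
apply: ball_coverable_burning_number; rewrite -(spread_parents syme rooted).
apply: ball_coverable_sub (ball_coverable_spread cov) => r.
by rewrite -(iotaDl 1) !mem_iota; lia.
Qed.

Lemma tree_class3_burning_number (T : finType) (e : rel T) (k : nat) :
  tree_class 3 e -> #|T| <= k ^ 2 -> burning_number e <= k.
Proof.
move=> tc; have le_int := card_internal_leq (ltn0Sn 2) tc.
case: k => [|s] le_T; first by lia.
apply: tree_burning_number; first by case: tc.
by have := mul_bin_diag s.+1 1; rewrite /= bin1; lia.
Qed.

Lemma ceil_sqrt_nat (n : nat) : exists2 k : nat, ceil_sqrt n = k & n <= k ^ 2.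
Proof.
have sqrt_ge0 : (0 <= sqrtC (n%:R : algC))%R by rewrite sqrtC_ge0 ler0n.
have ceil_ge0 : (0 <= ceil_sqrt n)%R.
  by rewrite real_ceil_ge0 ?ger0_real // (lt_le_trans (ltrN10 _)).
exists `|ceil_sqrt n|; first by rewrite gez0_abs.
rewrite -(ler_nat algC) -[leLHS](sqrtCK n%:R)%R natrX natr_absz ger0_norm //.
by rewrite lerXn2r ?nnegrE ?ler0z ?real_ceil_ge ?ger0_real.
Qed.

Lemma tree_class3_well_burnable (T : finType) (e : rel T) :
  tree_class 3 e -> well_burnable e.
Proof.
move=> tc; have [k ceilE le_k] := ceil_sqrt_nat #|T|.
by rewrite /well_burnable ceilE lez_nat; apply: tree_class3_burning_number.
Qed.

Lemma tree_classW (d d' : nat) (T : finType) (e : rel T) :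
  d <= d' -> tree_class d' e -> tree_class d e.
Proof. by move=> led [tree_e deg]; split=> // x /deg; apply: leq_trans. Qed.

Theorem theorem9 :
  (forall (d : nat) (T : finType) (e : rel T),
      4 <= d -> tree_class d e -> well_burnable e) /\
  (forall (T : finType) (e : rel T),
      tree_class 3 e -> 81 <= #|T| -> well_burnable e).
Proof.
split=> [d T e d_ge4|T e tc _]; last exact: tree_class3_well_burnable.
by move/(tree_classW (ltnW d_ge4)); apply: tree_class3_well_burnable.
Qed.
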